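(* Every left divisibility monoid is biautomatic; that is, for every left divisibility monoid $M$ there exist a finite generating set $X$ of $M$ and a language $L\subseteq X^*$ mapping onto $M$ such that $(X,L)$ is a biautomatic structure for $M$.
   Context: Let $M$ be a monoid. For $a,b\in M$, $b$ is a left divisor of $a$ if $a=bd$ for some $d\in M$. The set of left divisors of $a$ is denoted $\downarrow(a)$. An element $a\neq 1$ is irreducible if $a=bc$ implies $b=1$ or $c=1$. A left divisibility monoid is a cancellative monoid, finitely generated by its irreducible elements (so the set of irreducible elements is finite and generates), in which any two elements admit a left gcd (greatest lower bound for left divisibility), and such that for every element $a$ the set $\downarrow(a)$, ordered by left divisibility, is a finite distributive lattice. A language is regular if it is the set of words recognized by a finite automaton. For a monoid $M$ generated by a set $X$, $w\mapsto\overline{w}$ is the canonical map $X^*\to M$. For an alphabet $X$ and a padding symbol $\$\notin X$, put $Y=(X\cup\{\$\})\times(X\cup\{\$\})\setminus\{(\$,\$)\}$. For $u,v\in X^*$, the word $\overrightarrow{(u,v)}_X\in Y^*$ is obtained by padding the shorter of $u,v$ on the right with symbols $\$$ to the length of the longer one and reading the two words letter by letter in parallel; $\overleftarrow{(u,v)}_X\in Y^*$ is defined in the same way with the padding on the left. Let $X$ be a finite generating set of $M$ and $L\subseteq X^*$ a language mapping onto $M$. Then $(X,L)$ is: - a left-left automatic structure if $\{\overleftarrow{(u,v)}_X: u,v\in L,\ \overline{x}\,\overline{u}=\overline{v}\}$ is regular for every $x\in X\cup\{\varepsilon\}$; - a right-left automatic structure if $\{\overrightarrow{(u,v)}_X: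 u,v\in L,\ \overline{x}\,\overline{u}=\overline{v}\}$ is regular for every $x\in X\cup\{\varepsilon\}$; - a left-right automatic structure if $\{\overleftarrow{(u,v)}_X: u,v\in L,\ \overline{u}\,\overline{x}=\overline{v}\}$ is regular for every $x\in X\cup\{\varepsilon\}$; - a right-right automatic structure if $\{\overrightarrow{(u,v)}_X: u,v\in L,\ \overline{u}\,\overline{x}=\overline{v}\}$ is regular for every $x\in X\cup\{\varepsilon\}$. $(X,L)$ is a biautomatic structure (both left and right biautomatic) if it is simultaneously a left-left, right-left, left-right and right-right automatic structure. *)

(* Defs.v *)
From HB Require Import structures.
From mathcomp Require Import all_boot all_order finmap zify.
From mathcomp Require Import classical_sets cardinality.

Set Implicit Arguments.
Unset Strict Implicit.
Unset Printing Implicit Defensive.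

Local Open Scope classical_set_scope.
Local Open Scope group_scope.

Section DivisibilityMonoid.
Variable M : monoidType.
Implicit Types (a b c d g : M) (A : set M).

Definition left_divisor b a : Prop := exists d, a = b * d.

Definition left_divisors a : set M := [set b | left_divisor b a].

Definition irreducible a : Prop :=
  a <> 1 /\ forall b c, a = b * c -> b = 1 \/ c = 1.

Definition cancellative : Prop :=
  (forall a b c, a * b = a * c -> b = c) /\
  (forall a b c, b * a = c * a -> b = c).

Definition generates A : Prop :=
  forall a, exists s : seq M, (forall x, x \in s -> A x) /\ \prod_(x <- s) x = a.

Definition is_left_gcd a b g : Prop :=
  [/\ left_divisor g a, left_divisor g b &
      forall d, left_divisor d a -> left_divisor d b -> left_divisor d g].

(* [A], ordered by left divisibility, is order isomorphic to a finite
   distributive lattice [T].  Antisymmetry of left divisibility on [A] is part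
   of this, since it holds in [T]. *)
Definition finite_distributive_lattice A : Prop :=
  exists (disp : Order.disp_t) (T : finDistrLatticeType disp) (f : T -> M),
    [/\ injective f,
        range f = A &
        forall x y : T, (x <= y)%O <-> left_divisor (f x) (f y)].

Definition left_divisibility_monoid : Prop :=
  [/\ cancellative,
      finite_set [set a | irreducible a] /\ generates [set a | irreducible a],
      forall a b, exists g, is_left_gcd a b g &
      forall a, finite_distributive_lattice (left_divisors a)].

End DivisibilityMonoid.

Definition regular (A : finType) (K : set (seq A)) : Prop :=
  exists (Q : finType) (init : Q) (step : Q -> A -> Q) (final : {set Q}),
    forall w : seq A, K w <-> foldl step init w \in final.

Section Padding.
Local Open Scope nat_scope.
Variable A : finType.
Implicit Types u v : seq A.

(* [None] is the padding symbol. *)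
Definition pair_letter : finType :=
  {p : option A * option A | p != (None, None)}.

Definition rpad n u : seq (option A) := map some u ++ nseq (n - size u) None.
Definition lpad n u : seq (option A) := nseq (n - size u) None ++ map some u.

(* [pmap insub] only recasts the letters: by [val_right_padded] and
   [val_left_padded] it never drops one. *)
Definition right_padded u v : seq pair_letter :=
  let n := maxn (size u) (size v) in pmap insub (zip (rpad n u) (rpad n v)).

Definition left_padded u v : seq pair_letter :=
  let n := maxn (size u) (size v) in pmap insub (zip (lpad n u) (lpad n v)).

Let val_pmap_insub (s : seq (option A * option A)) :
  (None, None) \notin s -> map val (pmap insub s : seq pair_letter) = s.
Proof.
move=> Ns; rewrite (pmap_filter (insubK _)); apply/all_filterP/allP => p ps /=.
by rewrite isSome_insub; apply: contraNneq Ns => <-.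
Qed.

Let size_rpad n u : size u <= n -> size (rpad n u) = n.
Proof. by move=> le_un; rewrite size_cat size_map size_nseq subnKC. Qed.

Let size_lpad n u : size u <= n -> size (lpad n u) = n.
Proof. by move=> le_un; rewrite size_cat size_map size_nseq subnK. Qed.

Let nth_rpad n u i : nth None (rpad n u) i = None -> size u <= i.
Proof.
rewrite nth_cat size_map leqNgt; case: ltnP => // lt_iu.
by case: u lt_iu => // a u lt_iu; rewrite (nth_map a).
Qed.

Let nth_lpad n u i : i < n -> nth None (lpad n u) i = None -> i < n - size u.
Proof.
rewrite nth_cat size_nseq nth_nseq => lt_in; case: (ltnP i (n - size u)) => // le_ni.
have lt_iu : i - (n - size u) < size u by lia.
by case: u le_ni lt_iu => // a u le_ni lt_iu; rewrite (nth_map a).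
Qed.

Lemma val_right_padded u v :
  map val (right_padded u v) =
  zip (rpad (maxn (size u) (size v)) u) (rpad (maxn (size u) (size v)) v).
Proof.
apply: val_pmap_insub; set n := maxn _ _.
have [un vn] : size u <= n /\ size v <= n by rewrite leq_maxl leq_maxr.
apply/negP => /(nthP (None, None)) [i].
rewrite size_zip !size_rpad // minnn nth_zip ?size_rpad // => lt_in.
by case=> /nth_rpad ui /nth_rpad vi; rewrite ltnNge geq_max ui vi in lt_in.
Qed.

Lemma val_left_padded u v :
  map val (left_padded u v) =
  zip (lpad (maxn (size u) (size v)) u) (lpad (maxn (size u) (size v)) v).
Proof.
apply: val_pmap_insub; set n := maxn _ _.
have [un vn] : size u <= n /\ size v <= n by rewrite leq_maxl leq_maxr.
apply/negP => /(nthP (None, None)) [i].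
rewrite size_zip !size_lpad // minnn nth_zip ?size_lpad // => lt_in.
case=> /(nth_lpad lt_in) ui /(nth_lpad lt_in) vi; rewrite /n in ui vi; lia.
Qed.

End Padding.

Section Automatic.
Variables (M : monoidType) (X : {fset M}).

Definition word_value (w : seq X) : M := \prod_(x <- w) val x.

Definition maps_onto (L : set (seq X)) : Prop :=
  forall a, exists w, L w /\ word_value w = a.

(* In the next four definitions, [x] ranges over the words of length at most 1,
   i.e. over the letters and the empty word. *)
Definition left_left_automatic (L : set (seq X)) : Prop :=
  forall x : seq X, (size x <= 1)%N ->
    regular [set w | exists u v, [/\ L u, L v,
      word_value x * word_value u = word_value v & w = left_padded u v]].

Definition right_left_automatic (L : set (seq X)) : Prop :=
  forall x : seq X, (size x <= 1)%N ->
    regular [set w | exists u v, [/\ L u, L v,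
      word_value x * word_value u = word_value v & w = right_padded u v]].

Definition left_right_automatic (L : set (seq X)) : Prop :=
  forall x : seq X, (size x <= 1)%N ->
    regular [set w | exists u v, [/\ L u, L v,
      word_value u * word_value x = word_value v & w = left_padded u v]].

Definition right_right_automatic (L : set (seq X)) : Prop :=
  forall x : seq X, (size x <= 1)%N ->
    regular [set w | exists u v, [/\ L u, L v,
      word_value u * word_value x = word_value v & w = right_padded u v]].

Definition biautomatic_structure (L : set (seq X)) : Prop :=
  [/\ left_left_automatic L, right_left_automatic L,
      left_right_automatic L & right_right_automatic L].

End Automatic.

Definition biautomatic (M : monoidType) : Prop :=
  exists (X : {fset M}) (L : set (seq X)),
    [/\ generates [set x | x \in X], maps_onto L & biautomatic_structure L].

(* Main.v *)
Require Import Defs.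
From mathcomp Require Import all_boot all_order finmap zify.
From mathcomp Require Import boolp classical_sets cardinality.

Set Implicit Arguments.
Unset Strict Implicit.
Unset Printing Implicit Defensive.
Import Order.TTheory.
Local Open Scope classical_set_scope.

(** The generators are the simple elements, those that are the join of the
    irreducibles below them, and the language is the one of greedy (Foata)
    normal forms [s1 ... sn], in which every [si] is the largest simple left
    divisor of [si ... sn].  A simple element is determined by the irreducibles
    below it, so there are finitely many of them ([finite_simple]).  Greediness
    is a condition on pairs of consecutive letters ([normal_irreducible]), so
    the normal forms are a regular set of unique representatives.

    Distributivity enters through two facts about divisors of a fixed element:
    joining an irreducible to [a] either changes nothing or multiplies [a] by
    one irreducible ([irreducible_push]), and coatoms are meet-prime
    ([cover_meet_prime]).  They imply that simple elements are closed under
    left and right divisors.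

    Multiplication by a generator is followed by keeping track of a difference
    that always remains simple.  If [k s1 ... sn = t1 ... tm] with both words
    normal, then [k s1 = t1 k'] for a simple [k'] that takes the place of [k]
    for the remaining letters ([left_mul_run]).  If [s1 ... sn k = t1 ... tm],
    there are simple [ei] with [s1 ... si ei = t1 ... ti] ([right_mul_run]).
    They are found from right to left: if [s(i+1) e(i+1)] is the current first
    letter, the largest simple left divisor of [si s(i+1) e(i+1)] is [si ei],
    and the remainder becomes the next letter.  That the new word is again
    normal is the [domino] lemma.

    Hence the pairs of normal forms related by left or right multiplication,
    padded on the right, form the intersection of a regular set of padded pairs
    with the set of words that label a path in a finite graph.  As the second
    word is as long as the first or longer by one, the same pairs padded on the
    left are read by an automaton with a one-letter buffer
    ([regular_left_padded]). *)

(** * Regular languages *)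

Section Regular.
Variable A : finType.
Implicit Types (K : set (seq A)) (w : seq A).

Lemma regular_setI K K' : regular K -> regular K' -> regular (K `&` K').
Proof.
move=> [Q [q0 [step [F KE]]]] [Q' [q0' [step' [F' KE']]]].
exists (Q * Q')%type, (q0, q0'), (fun q a => (step q.1 a, step' q.2 a)).
exists (finset.setX F F') => w.
have -> : foldl (fun q a => (step q.1 a, step' q.2 a)) (q0, q0') w =
          (foldl step q0 w, foldl step' q0' w).
  by elim: w q0 q0' {KE KE'} => //= a w IHw q0 q0'; rewrite IHw.
rewrite finset.in_setX; split=> [[/KE -> /KE' ->] //|/andP[/KE ? /KE' ?]]; by split.
Qed.

Lemma regular_setC K : regular K -> regular (~` K).
Proof.
move=> [Q [q0 [step [F KE]]]]; exists Q, q0, step, (finset.setC F) => w.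
rewrite finset.in_setC; split=> [nK|/negP nF /KE //].
by apply/negP => /KE.
Qed.

Lemma regular_setU K K' : regular K -> regular K' -> regular (K `|` K').
Proof.
move=> rK rK'; rewrite -[_ `|` _]setCK setCU.
by apply/regular_setC/regular_setI; apply: regular_setC.
Qed.

Lemma regular_all (P : pred A) : regular [set w | all P w].
Proof.
exists bool, true, (fun b a => b && P a), [set true]%SET => w; rewrite finset.inE.
suff -> b : foldl (fun b a => b && P a) b w = b && all P w.
  by split=> [-> //|/eqP].
by elim: w b => [|a w IHw] b /=; rewrite ?andbT // IHw andbA.
Qed.

(** Reading from right to left is no more powerful: reading from left to right,
    one keeps the set of states from which the part already read leads to [F]. *)
Lemma regular_foldr (Q : finType) (q0 : Q) (step : A -> Q -> Q) (F : {set Q}) :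
  regular [set w | foldr step q0 w \in F].
Proof.
exists {set Q}, F, (fun (G : {set Q}) a => [set q | step a q \in G]%SET),
  [set G : {set Q} | q0 \in G]%SET.
move=> w /=; rewrite finset.inE.
suff -> q G : (q \in foldl (fun (G : {set Q}) a => [set q | step a q \in G]%SET) G w)
    = (foldr step q w \in G) by [].
by elim: w q G => //= a w IHw q G; rewrite IHw finset.inE.
Qed.

(** Paths of a nondeterministic automaton.  Edges are propositions, so that they
    can be given by equations in a monoid. *)
Fixpoint run (Q : Type) (E : Q -> A -> Q -> Prop) q w q' : Prop :=
  if w is a :: w then exists2 q1, E q a q1 & run E q1 w q' else q = q'.

Lemma regular_run (Q : finType) (E : Q -> A -> Q -> Prop) q q' :
  regular [set w | run E q w q'].
Proof.
pose step a (G : {set Q}) := [set q | `[< exists2 q1, E q a q1 & q1 \in G >]]%SET.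
have [] := regular_foldr [set q']%SET step [set G : {set Q} | q \in G]%SET.
move=> Q' [q0' [step' [F' KE]]]; exists Q', q0', step', F' => w.
rewrite -KE /= finset.inE => {KE}; elim: w q => [|a w IHw] q /=.
  by rewrite finset.inE; split=> [->|/eqP].
by rewrite finset.inE; split=> [[q1 e /IHw r]|/asboolP[q1 e /IHw r]];
  [apply/asboolP|]; exists q1.
Qed.

End Regular.

(** * Padded pairs of words *)

Section Padded.
Variable A : finType.
Implicit Types (u v : seq A) (a b : A).

Definition both a b : pair_letter A := exist _ (Some a, Some b) isT.
Definition left_only a : pair_letter A := exist _ (Some a, None) isT.
Definition right_only b : pair_letter A := exist _ (None, Some b) isT.

Variant letter_spec : pair_letter A -> Prop :=
| LetterBoth a b : letter_spec (both a b)
| LetterLeft a : letter_spec (left_only a)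
| LetterRight b : letter_spec (right_only b).

Lemma letterP l : letter_spec l.
Proof.
case: l => -[[a|] [b|]] // ne; rewrite (bool_irrelevance ne isT);
  [exact: LetterBoth | exact: LetterLeft | exact: LetterRight].
Qed.

Lemma right_padded_cons a b u v :
  right_padded (a :: u) (b :: v) = both a b :: right_padded u v.
Proof. by apply: (inj_map val_inj); rewrite /= !val_right_padded /= maxnSS /rpad !subSS. Qed.

Lemma right_padded_consl a u :
  right_padded (a :: u) [::] = left_only a :: right_padded u [::].
Proof.
by apply: (inj_map val_inj); rewrite /= !val_right_padded /= !maxn0 /rpad subSS subn0.
Qed.

Lemma right_padded_consr b v :
  right_padded [::] (b :: v) = right_only b :: right_padded [::] v.
Proof.
by apply: (inj_map val_inj); rewrite /= !val_right_padded /= !max0n /rpad subSS subn0.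
Qed.

Definition right_paddedE := (right_padded_cons, right_padded_consl, right_padded_consr).

Lemma right_padded_ind (P : seq A -> seq A -> Prop) :
  P [::] [::] -> (forall a u, P u [::] -> P (a :: u) [::]) ->
  (forall b v, P [::] v -> P [::] (b :: v)) ->
  (forall a u b v, P u v -> P (a :: u) (b :: v)) -> forall u v, P u v.
Proof.
move=> P0 Pl Pr P2; elim=> [|a u IHu] [|b v] //; last by apply: P2.
  by elim: v b => [|c v IHv] b; apply: Pr.
exact: Pl.
Qed.

Lemma right_padded_inj u v u' v' :
  right_padded u v = right_padded u' v' -> u = u' /\ v = v'.
Proof.
move: u v u' v'; apply: right_padded_ind => [|a u IH|b v IH|a u b v IH] [|a' u'] [|b' v'];
  rewrite ?right_paddedE //.
- by move=> [-> /IH[->]].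
- by move=> [-> /IH[_ ->]].
- by move=> [-> -> /IH[-> ->]].
Qed.

Lemma left_padded_eq_size u v : size u = size v -> left_padded u v = right_padded u v.
Proof.
move=> e; apply: (inj_map val_inj); rewrite val_left_padded val_right_padded.
by rewrite e maxnn /lpad /rpad e subnn !cats0.
Qed.

Lemma left_padded_cons u b v : size u = size v ->
  left_padded u (b :: v) = right_only b :: right_padded u v.
Proof.
move=> e; apply: (inj_map val_inj); rewrite /= val_left_padded val_right_padded.
rewrite /= e maxnn (maxn_idPr _) ?leqnSn // /lpad /rpad /= e subnn.
by rewrite subSn ?leqnn // subnn !cats0.
Qed.

(** An automaton is completed by two states that describe what may follow once
    the padding has begun: [inr true] accepts the empty word only, and
    [inr false] accepts nothing.  Then the possible continuations of a padded
    pair of words are again described by a pair of states. *)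
Section EndOfWord.
Variables (Q : finType) (step : Q -> A -> Q) (F : {set Q}).

Definition padded_step (q : Q + bool) (c : option A) : Q + bool :=
  match q, c with
  | inl q, Some a => inl (step q a)
  | inl q, None => inr (q \in F)
  | inr _, Some _ => inr false
  | inr e, None => inr e
  end.

Definition padded_final (q : Q + bool) : bool :=
  match q with inl q => q \in F | inr e => e end.

Definition padded_accepts q u : bool :=
  padded_final (foldl (fun q a => padded_step q (Some a)) q u).

Lemma padded_accepts_inl q u : padded_accepts (inl q) u = (foldl step q u \in F).
Proof. by rewrite /padded_accepts; elim: u q => /=. Qed.

Lemma padded_accepts_end q u :
  padded_accepts (padded_step q None) u <-> u = [::] /\ padded_accepts q [::].
Proof.
case: u => [|a u]; first by case: q; split=> // -[].
suff -> : padded_accepts (padded_step q None) (a :: u) = false by split=> // -[].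
by case: q => q; rewrite /padded_accepts /=; elim: u.
Qed.

End EndOfWord.

Lemma regular_right_padded (K K' : set (seq A)) : regular K -> regular K' ->
  regular [set w | exists u v, [/\ K u, K' v & w = right_padded u v]].
Proof.
move=> [Q [q0 [step [F KE]]]] [Q' [q0' [step' [F' KE']]]].
pose step2 (q : (Q + bool) * (Q' + bool)) (l : pair_letter A) :=
  (padded_step step F q.1 (val l).1, padded_step step' F' q.2 (val l).2).
pose final2 := [set q : (Q + bool) * (Q' + bool) |
  padded_final F q.1 && padded_final F' q.2]%SET.
exists ((Q + bool) * (Q' + bool))%type, (inl q0, inl q0'), step2, final2 => w.
have main q q' : (foldl step2 (q, q') w \in final2) <->
   exists u v, [/\ padded_accepts step F q u, padded_accepts step' F' q' v &
     w = right_padded u v].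
  elim: w q q' => [|l w IHw] q q' /=.
    rewrite finset.inE; split=> [/andP[? ?]|[[|a u] [[|b v] []]]]; first by exists [::], [::].
    - by rewrite /padded_accepts /= => -> ->.
    - by rewrite right_paddedE.
    - by rewrite right_paddedE.
    - by rewrite right_paddedE.
  rewrite IHw; case: (letterP l) => [a b|a|b] /=; split.
  - by move=> [u [v [? ? ->]]]; exists (a :: u), (b :: v); rewrite right_paddedE.
  - move=> [[|c u] [[|d v] []]]; rewrite ?right_paddedE // => ? ? [-> -> ->].
    by exists u, v.
  - move=> [u [v [? /padded_accepts_end[-> ?] ->]]]; exists (a :: u), [::].
    by rewrite right_paddedE.
  - move=> [[|c u] [[|d v] []]]; rewrite ?right_paddedE // => ? ? [-> ->].
    by exists u, [::]; split=> //; apply/padded_accepts_end.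
  - move=> [u [v [/padded_accepts_end[-> ?] ? ->]]]; exists [::], (b :: v).
    by rewrite right_paddedE.
  - move=> [[|c u] [[|d v] []]]; rewrite ?right_paddedE // => ? ? [-> ->].
    by exists [::], v; split=> //; apply/padded_accepts_end.
by rewrite main; split=> -[u [v [Ku Kv ->]]]; exists u, v; split=> //;
  move: Ku Kv; rewrite !padded_accepts_inl => /KE Ku /KE' Kv.
Qed.

(** For words of equal length both paddings agree.  If [v] is longer by one
    letter, its letters arrive one step early: an automaton for the left-padded
    words holds back the latest letter of [v] and feeds the pairs of
    [right_padded u v] to the given automaton. *)
Lemma regular_left_padded (R : seq A -> seq A -> Prop) :
  (forall u v, R u v -> (size u <= size v <= (size u).+1)%N) ->
  regular [set w | exists u v, R u v /\ w = right_padded u v] ->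
  regular [set w | exists u v, R u v /\ w = left_padded u v].
Proof.
move=> Rsize regR.
pose full (l : pair_letter A) := ((val l).1 != None) && ((val l).2 != None).
have all_full u v : all full (right_padded u v) = (size u == size v).
  by move: u v; apply: right_padded_ind => [|a u _|b v _|a u b v IH];
    rewrite ?right_paddedE.
pose K1 := [set w | exists u v, R u v /\ w = right_padded u v] `&` [set w | all full w].
pose K2 := [set w | exists u b v, [/\ size u = size v, R u (b :: v) &
   w = right_only b :: right_padded u v]].
have -> : [set w | exists u v, R u v /\ w = left_padded u v] = K1 `|` K2.
  apply/seteqP; split=> w /=.
    move=> [u [v [Ruv ->]]]; case: ltngtP (Rsize _ _ Ruv) => //= uv.
      case: v Ruv uv => // b v Ruv /= uv vu; have e : size u = size v by lia.
      by right; exists u, b, v; rewrite left_padded_cons.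
    rewrite /= left_padded_eq_size // => _; left; split; last by rewrite /= all_full uv.
    by exists u, v.
  case=> [[[u [v [Ruv ->]]]]|[u [b [v [e Ruv ->]]]]].
    by rewrite /= all_full => /eqP e; exists u, v; rewrite left_padded_eq_size.
  by exists u, (b :: v); rewrite left_padded_cons.
apply: regular_setU.
  by apply: regular_setI => //; apply: regular_all.
case: regR => Q [q0 [step [F KE]]].
(* [None] rejects, [Some None] is the initial state, and in [Some (Some (q, t))]
   the letter [t] is the one held back. *)
pose step' (s : option (option (Q * A))) (l : pair_letter A) : option (option (Q * A)) :=
  match s, val l with
  | Some None, (None, Some b) => Some (Some (q0, b))
  | Some (Some (q, t)), (Some a, Some b) => Some (Some (step q (both a t), b))
  | _, _ => None end.
pose F' := [set s : option (option (Q * A)) |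
   if s is Some (Some (q, t)) then step q (right_only t) \in F else false]%SET.
exists (option (option (Q * A))), (Some None), step', F'.
have dead w : (foldl step' None w \in F') = false.
  by elim: w => //=; rewrite finset.inE.
have main w q t : (foldl step' (Some (Some (q, t))) w \in F') <->
    exists u v, [/\ size u = size v, w = right_padded u v &
       foldl step q (right_padded u (t :: v)) \in F].
  elim: w q t => [|l w IHw] q t /=.
    rewrite finset.inE; split=> [?|]; first by exists [::], [::]; rewrite right_paddedE.
    by move=> [[|a u] [[|b v] []]]; rewrite ?right_paddedE.
  case: (letterP l) => [a b|a|b]; rewrite /=.
  - rewrite IHw; split=> [[u [v [e -> acc]]]|[[|c u] [[|d v] []]]] //.
      by exists (a :: u), (b :: v); rewrite /= e !right_paddedE.
    by move=> [e]; rewrite !right_paddedE => -[-> -> ->] /= acc; exists u, v.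
  - rewrite dead; split=> // -[[|c u] [[|d v] []]]; by rewrite ?right_paddedE.
  - rewrite dead; split=> // -[[|c u] [[|d v] []]]; by rewrite ?right_paddedE.
case=> [|l w]; rewrite /K2 /=.
  by rewrite finset.inE; split=> // -[u [b [v []]]].
case: (letterP l) => [a b|a|b]; rewrite /=.
- by rewrite dead; split=> // -[u [c [v []]]].
- by rewrite dead; split=> // -[u [c [v []]]].
rewrite main; split.
  move=> [u [c [v [e Ruv [-> ->]]]]]; exists u, v; split=> //.
  by apply/KE; exists u, (c :: v).
move=> [u [v [e -> /KE[u1 [v1 [Ruv /right_padded_inj[eu ev]]]]]]].
by exists u, b, v; split=> //; rewrite eu ev.
Qed.

End Padded.

Local Open Scope group_scope.

(** * Divisors in a left divisibility monoid *)

Section Divisors.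
Variable M : monoidType.
Hypothesis M_ldm : left_divisibility_monoid M.
Implicit Types a b c d g h p q s t u v w x y z : M.

Local Notation "a <=| b" := (left_divisor a b) (at level 70, no associativity).

Let mulgI a b c : a * b = a * c -> b = c.
Proof. by case: M_ldm => -[+ _] _ _ _; apply. Qed.

Lemma ld_refl a : a <=| a. Proof. by exists 1; rewrite mulg1. Qed.

Lemma ld_mulr a b : a <=| a * b. Proof. by exists b. Qed.

Lemma ld1 a : 1 <=| a. Proof. by exists a; rewrite mul1g. Qed.

Lemma ld_trans b a c : a <=| b -> b <=| c -> a <=| c.
Proof. by move=> [d ->] [e ->]; exists (d * e); rewrite mulgA. Qed.

Lemma ld_mul2l c a b : c * a <=| c * b <-> a <=| b.
Proof.
by split=> -[d e]; exists d; [apply: (@mulgI c); rewrite mulgA | rewrite e mulgA].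
Qed.

(** Both [a] and [1] are divisors of [1], where left divisibility is
    antisymmetric. *)
Lemma mulg_eq1 a b : a * b = 1 -> a = 1 /\ b = 1.
Proof.
move=> ab1; suff a1 : a = 1 by split=> //; rewrite -ab1 a1 mul1g.
case: M_ldm => _ _ _ /(_ 1) [disp [T [f [_ rf lef]]]].
have [x _ fx] : range f a by rewrite rf; exists b.
have [y _ fy] : range f 1 by rewrite rf; apply: ld_refl.
rewrite -fx -fy; congr f; apply/le_anti/andP; split; apply/lef; rewrite fx fy.
  by exists b.
exact: ld1.
Qed.

Lemma ld_anti a b : a <=| b -> b <=| a -> a = b.
Proof.
move=> [d ->] [e]; rewrite -mulgA -[X in X = _ -> _]mulg1 => /mulgI /esym.
by move=> /mulg_eq1 [-> _]; rewrite mulg1.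
Qed.

Lemma ld_gcd a b : exists g, is_left_gcd a b g.
Proof. by case: M_ldm. Qed.

Lemma irreducible_divisor a : a <> 1 -> exists2 p, irreducible p & p <=| a.
Proof.
case: M_ldm => _ [_ /(_ a)[[|p s] [irr <-]]] _ _; rewrite ?big_nil //.
move=> _; exists p; first by apply: irr; rewrite mem_head.
by rewrite big_cons; apply: ld_mulr.
Qed.

Lemma ld_irreducible a p : irreducible p -> a <=| p -> a = 1 \/ a = p.
Proof.
move=> [_ irr] [d pE]; case: (irr _ _ pE) => e; first by left.
by right; rewrite pE e mulg1.
Qed.

Lemma finite_divisors a : finite_set (left_divisors a).
Proof.
case: M_ldm => _ _ _ /(_ a)[disp [T [f [_ <- _]]]].
exact/finite_image/finite_finset.
Qed.

(** A measure for well-founded induction that decreases both on proper left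
    divisors and on proper right divisors. *)
Definition divisor_count a := #|` fset_set (left_divisors a)|%fset.

Let mem_divisors a x : x \in fset_set (left_divisors a) <-> x <=| a.
Proof. by rewrite in_fset_set ?inE //; exact: finite_divisors. Qed.

Lemma divisor_count_left a b : a <=| b -> a <> b ->
  (divisor_count a < divisor_count b)%N.
Proof.
move=> ab ne; apply/fproper_ltn_card/andP; split.
  by apply/fsubsetP => x /mem_divisors xa; apply/mem_divisors/(ld_trans xa).
apply/fsubsetPn; exists b; first exact/mem_divisors/ld_refl.
by apply/negP => /mem_divisors ba; apply/ne/ld_anti.
Qed.

Lemma divisor_count_right a b : a <> 1 -> (divisor_count b < divisor_count (a * b))%N.
Proof.
move=> a1.
have <- : #|` [fset a * x | x in fset_set (left_divisors b)]|%fset = divisor_count b.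
  exact: card_imfset (@mulgI a).
apply/fproper_ltn_card/andP; split.
  apply/fsubsetP => _ /imfsetP[/= x /mem_divisors xa ->].
  exact/mem_divisors/ld_mul2l.
apply/fsubsetPn; exists 1; first exact/mem_divisors/ld1.
by apply/negP => /imfsetP[/= x _ /esym/mulg_eq1[]].
Qed.

Lemma divisor_lattice w :
  exists (disp : Order.disp_t) (T : finDistrLatticeType disp) (f : T -> M),
    [/\ forall i j : T, (i <= j)%O <-> f i <=| f j, forall i, f i <=| w &
        forall a, a <=| w -> exists i, f i = a].
Proof.
case: M_ldm => _ _ _ /(_ w)[disp [T [f [_ rf lef]]]]; exists disp, T, f; split=> //.
  by move=> i; rewrite -[_ <=| _]/(left_divisors w (f i)) -rf; exists i.
by move=> a aw; have [i _ <-] : range f a by [rewrite rf]; exists i.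
Qed.

(** In a distributive lattice a coatom [t] is meet-prime: if neither [x] nor [y]
    is below [t], then [t] joined to each of them gives the top, hence so does
    [t] joined to their meet. *)
Lemma cover_meet_prime t z x y g : irreducible z -> x <=| t * z -> y <=| t * z ->
  is_left_gcd x y g -> g <=| t -> x <=| t \/ y <=| t.
Proof.
move=> [z1 irr] xw yw [gx gy gmax] gt.
have [disp [T [f [lef fw pre]]]] := divisor_lattice (t * z).
have [[i fi] [j fj]] := (pre _ xw, pre _ yw).
have [[k fk] [m fm]] := (pre _ (ld_mulr t z), pre _ (ld_refl (t * z))).
have top l : (l <= m)%O by apply/lef; rewrite fm.
have cover l : (k `|` l)%O = m \/ f l <=| t.
  have /lef := leUl k l; rewrite fk => -[c fc].
  have /lef := top (k `|` l)%O; rewrite fm => -[d]; rewrite fc -mulgA => /mulgI zE.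
  case: (irr _ _ zE) => e; [right|left].
    by rewrite -[t]mulg1 -e -fc; apply/lef; rewrite leUr.
  by apply/le_anti; rewrite top; apply/lef; rewrite fm fc zE e mulg1; apply: ld_refl.
case: (cover i) => [ki|]; last by rewrite fi; left.
case: (cover j) => [kj|]; last by rewrite fj; right.
case: z1; have ijk : (i `&` j <= k)%O.
  apply/lef; rewrite fk; apply: ld_trans gt; apply: gmax.
    by rewrite -fi; apply/lef; rewrite leIl.
  by rewrite -fj; apply/lef; rewrite leIr.
have := joinIr k i j; rewrite ki kj meetxx (join_l ijk) => km.
by apply: (@mulgI t); rewrite mulg1 -fm -km fk.
Qed.

(** The join of [a] and [p] is a multiple [a * c], and [c] is irreducible: by
    distributivity an element between [a] and this join is the join of [a] with
    a divisor of [p]. *)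
Lemma irreducible_push p a b : irreducible p -> p <=| a * b ->
  p <=| a \/ exists c, [/\ irreducible c, c <=| b & p <=| a * c].
Proof.
move=> pirr pab; case: (pselect (p <=| a)) => pa; [by left | right].
have [disp [T [f [lef fw pre]]]] := divisor_lattice (a * b).
have [[i fi] [k fk]] := (pre _ pab, pre _ (ld_mulr a b)).
have /lef := leUl k i; rewrite fk => -[c fc].
have pac : p <=| a * c by rewrite -fc -fi; apply/lef; rewrite leUr.
exists c; split=> //; last by rewrite -(ld_mul2l a) -fc.
split=> [c1|c1 c2 cE]; first by rewrite c1 mulg1 in pac.
have ac1 : a * c1 <=| a * c by apply/ld_mul2l; rewrite cE; apply: ld_mulr.
have [l fl] := pre _ (ld_trans ac1 (eq_ind _ (fun x => x <=| _) (fw (k `|` i)%O) _ fc)).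
have kl : (k <= l)%O by apply/lef; rewrite fk fl; apply: ld_mulr.
have lki : (l <= k `|` i)%O by apply/lef; rewrite fl fc.
have lE : l = (k `|` (i `&` l))%O.
  by rewrite joinIr (join_r kl) meetC; apply/esym/meet_l.
have : f (i `&` l)%O <=| p by rewrite -fi; apply/lef; rewrite leIl.
case/(ld_irreducible pirr) => e; [left|right].
  have il_k : (i `&` l <= k)%O by apply/lef; rewrite e; apply: ld1.
  by apply: (@mulgI a); rewrite -fl lE (join_l il_k) fk mulg1.
have il : (i <= l)%O.
  by apply/lef; rewrite fi -e; apply/lef; rewrite leIr.
apply: (@mulgI (a * c1)); rewrite -[LHS]mulgA -cE mulg1 -fc -fl; congr f.
by apply/le_anti; rewrite lki andbT leUx kl il.
Qed.

(** * Simple elements *)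

(** An element is simple when it is the least upper bound of the irreducibles
    below it.  Equivalently, its lattice of divisors is Boolean. *)
Definition simple w :=
  forall b, b <=| w -> (forall p, irreducible p -> p <=| w -> p <=| b) -> b = w.

Lemma simple_le w a : simple w ->
  (forall p, irreducible p -> p <=| w -> p <=| a) -> w <=| a.
Proof.
move=> sw wa; have [g [gw ga gmax]] := ld_gcd w a.
rewrite -(sw g gw) // => p pirr pw; apply: gmax => //; exact: wa.
Qed.

Lemma simple1 : simple 1.
Proof. by move=> b b1 _; apply: ld_anti b1 (ld1 b). Qed.

Lemma irreducible_simple p : irreducible p -> simple p.
Proof. by move=> pirr b bp pb; apply: ld_anti bp (pb p pirr (ld_refl p)). Qed.

Lemma not_simple_le w b : simple w -> b <=| w -> b <> w ->
  exists p, [/\ irreducible p, p <=| w & ~ p <=| b].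
Proof.
move=> sw bw ne; apply: contrapT => none; apply/ne/sw => // p pirr pw.
by apply: contrapT => pb; apply: none; exists p.
Qed.

(** Let [b] be a divisor of [u] above all irreducibles below [u].  Every [c]
    between [b] and the simple element [u * v] is a multiple of [u], by induction
    downwards from [u * v]: if [c] is not the top, some irreducible [p] is not
    below [c], the result holds for the join of [c] and [p], which covers [c],
    and the meet of [u] and [p] is trivial, so that [u] is below [c] since [c] is
    meet-prime.  Take [c = b]. *)
Lemma simple_mull u v : simple (u * v) -> simple u.
Proof.
move=> suv b bu ub; apply: (ld_anti bu).
suff main n c d : (divisor_count d < n)%N -> b <=| c -> u * v = c * d -> u <=| c.
  have [d uvE] := ld_trans bu (ld_mulr u v).
  exact: (main _ b d (leqnn _) (ld_refl b) uvE).
elim: n c d => // n IHn c d; rewrite ltnS => dn bc uvE.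
have [d1|d1] := pselect (d = 1); first by exists v; rewrite uvE d1 mulg1.
have [||p [pirr puv pc]] := @not_simple_le _ c suv; first by exists d.
  by rewrite uvE -[X in X = _]mulg1 => /mulgI /esym.
rewrite uvE in puv.
have [//|[p1 [p1irr [d' dE] pcp1]]] := irreducible_push pirr puv.
have ucp1 : u <=| c * p1.
  apply: (IHn _ d'); last by rewrite -mulgA -dE.
    by apply: leq_trans dn; rewrite dE; apply: divisor_count_right; case: p1irr.
  exact: ld_trans bc (ld_mulr _ _).
have [g gP] := ld_gcd u p; have [gu gp _] := gP.
have gc : g <=| c.
  have [->|gE] := ld_irreducible pirr gp; first exact: ld1.
  by case: pc; apply: ld_trans bc; apply: ub => //; rewrite -gE.
by have [] := cover_meet_prime p1irr ucp1 pcp1 gP gc.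
Qed.

(** An irreducible below [u * v] is below [u], or below [u * c] for an
    irreducible [c] below [v]; so an upper bound [b] of the irreducibles below
    [v] gives the upper bound [u * b] of those below [u * v]. *)
Lemma simple_mulr u v : simple (u * v) -> simple v.
Proof.
move=> suv b bv vb; apply: (@mulgI u); apply: suv; first exact/ld_mul2l.
move=> p pirr /(irreducible_push pirr)[pu|[c [cirr cv pc]]].
  exact: ld_trans pu (ld_mulr _ _).
by apply: ld_trans pc _; apply/ld_mul2l/vb.
Qed.

(** The join of the irreducibles below [a] is the largest simple left divisor
    of [a].  It is reached by descending from [a]: an upper bound of these
    irreducibles that is not simple has a smaller one below it. *)
Lemma head_ex a : exists h,
  [/\ simple h, h <=| a & forall p, irreducible p -> p <=| a -> p <=| h].
Proof.
suff main n h : (divisor_count h < n)%N -> h <=| a ->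
    (forall p, irreducible p -> p <=| a -> p <=| h) ->
    exists h, [/\ simple h, h <=| a & forall p, irreducible p -> p <=| a -> p <=| h].
  exact: (main _ a (leqnn _) (ld_refl a) (fun _ _ pa => pa)).
elim: n h => // n IHn h; rewrite ltnS => hn ha ah.
have [sh|] := pselect (simple h); first by exists h.
move=> /existsNP[b] /not_implyP[bh] /not_implyP[hb bNh].
apply: (IHn b); first exact: leq_trans (divisor_count_left bh bNh) hn.
  exact: ld_trans bh ha.
by move=> p pirr /(ah _ pirr); apply: hb.
Qed.

(** Two simple elements above the same irreducibles divide each other. *)
Lemma finite_simple : finite_set [set w | simple w].
Proof.
case: M_ldm => _ [finI _] _ _.
pose atoms w := [fset p in fset_set [set a | irreducible a] | `[< left_divisor p w >]]%fset.
have atomsP w p : p \in atoms w <-> irreducible p /\ p <=| w.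
  rewrite !inE in_fset_set //; split=> [/andP[+ /asboolP]|[pirr pw]].
    by rewrite inE.
  by apply/andP; split; [rewrite inE | apply/asboolP].
have atoms_sub w w' : simple w -> atoms w = atoms w' -> w <=| w'.
  move=> sw e; apply: simple_le => // p pirr pw.
  by have /atomsP[] : p \in atoms w' by rewrite -e; apply/atomsP.
have inj : {in [set w | simple w] &, injective atoms}.
  move=> w w'; rewrite !inE => sw sw' e.
  by apply: ld_anti; apply: atoms_sub.
rewrite -(eq_finite_set (inj_card_eq inj)).
apply: (@sub_finite_set _ _ [set` fpowerset (fset_set [set a | irreducible a])]).
  by move=> _ [w _ <-] /=; rewrite fpowersetE; apply: fset_sub.
exact: finite_fset.
Qed.

(** * Greedy normal forms *)

(** For a simple [s] this says that [s] is the largest simple left divisor of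
    [s * t]. *)
Definition normal_pair s t := forall p, irreducible p -> p <=| s * t -> p <=| s.

Lemma normal_pair_simple_r s t u : normal_pair s t -> simple (s * u) -> u <=| t -> u = 1.
Proof.
move=> st su ut; apply: (@mulgI s); rewrite mulg1; apply/esym/su; first exact: ld_mulr.
by move=> p pirr psu; apply: st => //; apply: ld_trans psu _; apply/ld_mul2l.
Qed.

(** The gcd of [c * b] and [c * r] is [c] times that of [b] and [r], which is
    trivial. *)
Lemma ld_mul_coprime a b c r : irreducible r -> ~ r <=| b ->
  a <=| c * b -> a <=| c * r -> a <=| c.
Proof.
move=> rirr rb acb acr; have [k [kb kr kmax]] := ld_gcd (c * b) (c * r).
have [d kE] : c <=| k by apply: kmax; apply: ld_mulr.
have dr : d <=| r by apply/(ld_mul2l c); rewrite -kE.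
case: (ld_irreducible rirr dr) => dE; first by rewrite -[c]mulg1 -dE -kE; apply: kmax.
by case: rb; rewrite -dE; apply/(ld_mul2l c); rewrite -kE.
Qed.

(** The equation [e' * q = s * e] is one square of the computation of a normal
    form from right to left: the letter [s * e] is replaced by [q] because the
    letter [s'] to its left absorbs [e'].  Suppose that some irreducible [p]
    below [q * z], with [z] an irreducible divisor of [t], is not below [q].  As
    [e * z] is simple, there is also an irreducible [p'] below [e * z] that is not
    below [e].  Both [s * p'] and [e' * p] are divisors of [s * e * z] not below
    its coatom [s * e], so neither is their gcd [g].  On the other hand an
    irreducible below [g] is below [s * e] by normality, hence below both [s] and
    [e'].  But [s] and [e'] have no common irreducible divisor, since [s'] is the
    largest simple left divisor of [s' * s] and [s' * e'] is simple. *)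
Lemma domino s e s' e' q t :
  normal_pair s' s -> simple (s' * e') -> e' * q = s * e -> simple (e * t) ->
  normal_pair (s * e) t -> normal_pair q t.
Proof.
move=> s's se' qE et set_ p pirr /(irreducible_push pirr)[//|[z [zirr zt pqz]]].
apply: contrapT => pq.
have {}et : simple (e * z) by case: zt et => d ->; rewrite mulgA => /simple_mull.
have [||p' [p'irr p'ez p'e]] := @not_simple_le _ e et; first exact: ld_mulr.
  by rewrite -[X in X = _]mulg1 => /mulgI /esym; case: zirr.
have [g gP] := ld_gcd (s * p') (e' * p).
have xw : s * p' <=| s * e * z by rewrite -mulgA; apply/ld_mul2l.
have yw : e' * p <=| s * e * z by rewrite -qE -mulgA; apply/ld_mul2l.
have gNse : ~ g <=| s * e.
  move=> /(cover_meet_prime zirr xw yw gP)[/ld_mul2l //|].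
  by rewrite -qE => /ld_mul2l.
have [gx gy _] := gP.
have gN1 : g <> 1 by move=> g1; apply: gNse; rewrite g1; apply: ld1.
have [a airr ag] := irreducible_divisor gN1.
have ase : a <=| s * e.
  apply: set_ => //; apply: ld_trans ag _; apply: ld_trans gx _; apply: ld_trans xw _.
  exact/ld_mul2l.
have as_ : a <=| s by apply: ld_mul_coprime p'irr p'e ase (ld_trans ag gx).
have ae' : a <=| e'.
  by apply: ld_mul_coprime pirr pq _ (ld_trans ag gy); rewrite qE.
have s'a : simple (s' * a) by case: ae' se' => d ->; rewrite mulgA => /simple_mull.
by have [] := airr; rewrite (normal_pair_simple_r s's s'a as_).
Qed.

Section Words.
Variable X : {fset M}.
Hypothesis X_simple : forall a, a \in X <-> simple a.
Implicit Types (i j k : X) (l : seq X).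

Let simpleX i : simple (val i). Proof. exact/X_simple/valP. Qed.

Let toX a : simple a -> exists i : X, val i = a.
Proof. by move=> /X_simple aX; exists [` aX]%fset. Qed.

(** The padding symbol and the missing head of the empty word both stand
    for [1]. *)
Definition letter_value (o : option X) : M := oapp val 1 o.

Notation head_value l := (letter_value (ohead l)).

Lemma word_value_cons i l : word_value (i :: l) = val i * word_value l.
Proof. exact: big_cons. Qed.

Lemma word_value_nil : word_value ([::] : seq X) = 1.
Proof. exact: big_nil. Qed.

(** Every pair with second component [1] is normal, so the last letter is only
    required to differ from [1]. *)
Fixpoint normal l : Prop :=
  if l is i :: l' then [/\ val i <> 1, normal_pair (val i) (head_value l') & normal l']
  else True.

Lemma normal_pair1 s : normal_pair s 1.
Proof. by move=> p _; rewrite mulg1. Qed.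

(** The local condition on consecutive letters makes the first letter the
    largest simple left divisor of the whole word: an irreducible that is not
    below the first letter [i] is below [i * c] for an irreducible [c] below the
    rest, and [c] is below the second letter by induction. *)
Lemma normal_irreducible l p : normal l -> irreducible p ->
  p <=| word_value l -> p <=| head_value l.
Proof.
elim: l p => [|i l IHl] p; first by rewrite word_value_nil.
move=> [_ il nl] pirr; rewrite word_value_cons => /(irreducible_push pirr)[//|].
move=> [c [cirr /(IHl _ nl cirr) cl pic]]; apply: il => //.
by apply: ld_trans pic _; apply/ld_mul2l.
Qed.

Lemma head_value_ld l : head_value l <=| word_value l.
Proof.
by case: l => [|i l]; [apply: ld1 | rewrite word_value_cons; apply: ld_mulr].
Qed.

Lemma simple_le_head l s : normal l -> simple s -> s <=| word_value l ->
  s <=| head_value l.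
Proof.
move=> nl ss sl; apply: simple_le => // p pirr ps; apply: normal_irreducible => //.
exact: ld_trans ps sl.
Qed.

Lemma normal_eq1 l : normal l -> word_value l = 1 -> l = [::].
Proof. by case: l => // i l [i1 _ _]; rewrite word_value_cons => /mulg_eq1[]. Qed.

Lemma normal_inj l l' : normal l -> normal l' -> word_value l = word_value l' -> l = l'.
Proof.
elim: l l' => [|i l IHl] l' nl nl' e.
  by apply/esym/normal_eq1; rewrite // -e word_value_nil.
case: l' nl' e => [_|j l' nl'] e.
  by apply: normal_eq1; rewrite // e word_value_nil.
have ij : i = j.
  apply/val_inj/ld_anti.
    apply: (@simple_le_head (j :: l')) => //.
    by rewrite -e word_value_cons; apply: ld_mulr.
  apply: (@simple_le_head (i :: l)) => //.
  by rewrite e word_value_cons; apply: ld_mulr.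
move: e; rewrite !word_value_cons ij => /mulgI e; congr (_ :: _).
by apply: IHl e; [case: nl | case: nl'].
Qed.

Lemma normal_ex a : exists2 l, normal l & word_value l = a.
Proof.
have [n] := ubnP (divisor_count a); elim: n a => // n IHn a; rewrite ltnS => an.
have [->|a1] := pselect (a = 1); first by exists [::]; rewrite ?word_value_nil.
have [h [sh [b aE] hmax]] := head_ex a.
have h1 : h <> 1.
  have [p pirr pa] := irreducible_divisor a1 => h1.
  have [[]] := pirr; have := hmax _ pirr pa; rewrite h1 => p1.
  exact: ld_anti p1 (ld1 p).
have [|l nl lb] := IHn b.
  by apply: leq_trans an; rewrite aE; apply: divisor_count_right.
have [i ih] := toX sh; exists (i :: l); last by rewrite word_value_cons lb ih.
split=> //; rewrite ih // => p pirr ph; apply: hmax => //; rewrite aE.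
by apply: ld_trans ph _; apply/ld_mul2l; rewrite -lb; apply: head_value_ld.
Qed.

(** Reading from right to left, the state is the head of the suffix already
    read. *)
Lemma regular_normal : regular [set l | normal l].
Proof.
pose good i (o : option X) := `[< val i <> 1 /\ normal_pair (val i) (letter_value o) >].
pose step i (s : option (option X)) :=
  if s is Some o then if good i o then Some (Some i) else None else None.
have [Q [q0 [st [F KE]]]] := regular_foldr (Some None) step [set~ None]%SET.
exists Q, q0, st, F => l; rewrite -KE /= finset.in_setC finset.in_set1 => {KE}.
have -> : foldr step (Some None) l = if `[< normal l >] then Some (ohead l) else None.
  elim: l => [|i l IHl] /=; first by rewrite asboolT.
  rewrite IHl; case: asboolP => nl /=; last first.
    by rewrite asboolF // => -[].
  rewrite /good; case: asboolP => [[i1 il]|nil]; first by rewrite asboolT.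
  by rewrite asboolF // => -[? ? _]; apply: nil.
by case: asboolP => //; split.
Qed.

(** * Multiplication by a generator *)

(** Both multiplications use the same graph on the generators, with the two
    components of a padded pair in the roles of [f] and [g]; a path telescopes to
    an equation between products ([run_edge]). *)
Definition edge (A : finType) (f g : A -> M) i (x : A) j : Prop :=
  val i * f x = g x * val j.

Lemma run_edge (A : finType) (f g : A -> M) (w : seq A) i j : run (edge f g) i w j ->
  val i * \prod_(x <- w) f x = (\prod_(x <- w) g x) * val j.
Proof.
elim: w i => [|x w IHw] i /=; first by rewrite !big_nil mulg1 mul1g => ->.
by move=> [k e /IHw r]; rewrite !big_cons mulgA e -!mulgA r.
Qed.

Definition left_value (x : pair_letter X) := letter_value (val x).1.
Definition right_value (x : pair_letter X) := letter_value (val x).2.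

Lemma padded_value l l' :
  \prod_(x <- right_padded l l') left_value x = word_value l /\
  \prod_(x <- right_padded l l') right_value x = word_value l'.
Proof.
move: l l'; apply: right_padded_ind => [|i l [IH1 IH2]|j l [IH1 IH2]|i l j l' [IH1 IH2]];
  rewrite ?right_paddedE ?big_nil ?big_cons ?word_value_nil ?IH1 ?IH2 ?word_value_cons;
  by rewrite ?word_value_nil /left_value /right_value /= ?mul1g ?mulg1.
Qed.

(** Left multiplication: the first letter [j] of the product is the largest
    simple left divisor of [k * l], so [k] divides [j], and [j] divides [k * i]
    because an irreducible below [k * l] is below [k * i].  Hence [k * i = j * m],
    where [m] is a right divisor of [i] and therefore a generator. *)
Lemma left_mul_run i0 k l l' : val i0 = 1 -> normal l -> normal l' ->
  val k * word_value l = word_value l' ->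
  (size l <= size l' <= (size l).+1)%N /\
  run (edge left_value right_value) k (right_padded l l') i0.
Proof.
move=> i01; elim: l l' k => [|i l IHl] l' k nl nl' e.
  move: e; rewrite word_value_nil mulg1 => e.
  case: l' nl' e => [|j l'] nl' e.
    by split=> //=; apply: val_inj; rewrite i01 e word_value_nil.
  have kj : val k = val j.
    apply: ld_anti; last by rewrite e word_value_cons; apply: ld_mulr.
    by apply: (@simple_le_head (j :: l')) => //; rewrite e; apply: ld_refl.
  have l'0 : l' = [::].
    apply: normal_eq1; first by case: nl'.
    by apply: (@mulgI (val j)); rewrite -word_value_cons -e kj mulg1.
  rewrite l'0 right_paddedE; split=> //=; exists i0 => //.
  by rewrite /edge /left_value /right_value /= i01 kj.
case: l' nl' e => [|j l'] nl' e.
  have [] := nl => -[]; move: e; rewrite word_value_nil word_value_cons.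
  by move=> /mulg_eq1[_] /mulg_eq1[].
have [[_ _ nl1] [_ _ nl1']] := (nl, nl').
have kj : val k <=| val j.
  by apply: (@simple_le_head (j :: l')); rewrite // -e; apply: ld_mulr.
have [d dE] : val j <=| val k * val i.
  apply: simple_le => // p pirr pj.
  have : p <=| val k * word_value (i :: l).
    by rewrite e; apply: ld_trans pj (head_value_ld (j :: l')).
  case/(irreducible_push pirr) => [pk|[c [cirr cil pkc]]].
    exact: ld_trans pk (ld_mulr _ _).
  by apply: ld_trans pkc _; apply/ld_mul2l; apply: normal_irreducible cil.
have [m md] : exists m : X, val m = d.
  apply: toX; have [r jE] := kj; apply: (@simple_mulr r).
  suff -> : r * d = val i by [].
  by apply: (@mulgI (val k)); rewrite mulgA -jE dE.
have e1 : val m * word_value l = word_value l'.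
  apply: (@mulgI (val j)).
  by rewrite -(word_value_cons j) -e word_value_cons !mulgA dE -md.
have [sz r] := IHl l' m nl1 nl1' e1; split; first by rewrite /= !ltnS.
by rewrite right_paddedE /=; exists m => //; rewrite /edge /left_value /right_value /= dE md.
Qed.

Lemma greedy_step i k : exists j m n : X,
  [/\ val j = val i * val m, val m * val n = val k & normal_pair (val j) (val n)].
Proof.
have [h [sh [r hr] hmax]] := head_ex (val i * val k).
have [y hE] : val i <=| h.
  apply: simple_le => // p pirr pi; apply: hmax => //.
  exact: ld_trans pi (ld_mulr _ _).
have kE : val k = y * r by apply: (@mulgI (val i)); rewrite hr hE mulgA.
have [j jh] := toX sh.
have [m my] : exists m : X, val m = y by apply/toX/(@simple_mulr (val i)); rewrite -hE.
have [n nr] : exists n : X, val n = r by apply/toX/(@simple_mulr y); rewrite -kE.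
by exists j, m, n; split; rewrite ?jh ?my ?nr // => p pirr; rewrite -hr; apply: hmax.
Qed.

(** The normal form of [i * l * k] is built from right to left.  The statement
    keeps what the next step needs: the first letter of the normal form is
    [i * m], and [m] times the second letter is simple. *)
Lemma right_mul_run_cons k i l : normal (i :: l) ->
  exists m j l', [/\ val j = val i * val m, normal (j :: l'),
    simple (val m * head_value l'), (size l <= size l' <= (size l).+1)%N &
    run (edge right_value left_value) m (right_padded l l') k].
Proof.
elim: l i => [|i1 l IHl] i nil.
  have [j [m [n [jE mn jn]]]] := greedy_step i k.
  have j1 : val j <> 1 by rewrite jE => /mulg_eq1[i1 _]; case: nil.
  have [n1|n1] := pselect (val n = 1).
    exists m, j, [::]; split=> //=.
    - by split=> //; apply: normal_pair1.
    - by rewrite mulg1; apply: simpleX.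
    - by apply: val_inj; rewrite -mn n1 mulg1.
  exists m, j, [:: n]; split=> //=.
  - by split=> //; split=> //; apply: normal_pair1.
  - by rewrite mn; apply: simpleX.
  - rewrite right_paddedE /=; exists k => //.
    by rewrite /edge /left_value /right_value /= mul1g.
have [i_1 ii1 nil1] := nil.
have [m1 [j1 [l1 [j1E nj1 sm1 sz r]]]] := IHl i1 nil1.
have [j [m [n [jE mn jn]]]] := greedy_step i j1.
have sim : simple (val i * val m) by rewrite -jE; apply: simpleX.
(* If nothing remained, [i * i1] would be simple. *)
have n1 : val n <> 1.
  move=> n1; have [[]] := nil1; apply: (normal_pair_simple_r ii1); last exact: ld_refl.
  by apply: (@simple_mull _ (val m1)); rewrite -mulgA -j1E -mn n1 mulg1.
have [_ j1l1 nl1] := nj1.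
exists m, j, (n :: l1); split=> //=.
- split=> //; first by rewrite jE => /mulg_eq1[].
  split=> //; apply: (@domino (val i1) (val m1) (val i) (val m)) => //.
    by rewrite mn.
  by rewrite -j1E.
- by rewrite mn; apply: simpleX.
- rewrite right_paddedE /=; exists m1 => //.
  by rewrite /edge /left_value /right_value /= mn.
Qed.

Lemma right_mul_run i0 k l l' : val i0 = 1 -> normal l -> normal l' ->
  word_value l * val k = word_value l' ->
  (size l <= size l' <= (size l).+1)%N /\
  run (edge right_value left_value) i0 (right_padded l l') k.
Proof.
move=> i01 nl nl' e.
suff [l1 [nl1 sz r]] : exists l1, [/\ normal l1, (size l <= size l1 <= (size l).+1)%N &
    run (edge right_value left_value) i0 (right_padded l l1) k].
  suff -> : l' = l1 by [].
  apply: normal_inj => //; have := run_edge r.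
  by have [-> ->] := padded_value l l1; rewrite i01 mul1g e.
case: l nl {e} => [_|i l nl].
  have [k1|k1] := pselect (val k = 1).
    by exists [::]; split=> //=; apply: val_inj; rewrite i01.
  exists [:: k]; split=> //=; first by split=> //; apply: normal_pair1.
  rewrite right_paddedE; exists k => //.
  by rewrite /edge /left_value /right_value /= i01.
have [m [j [l1 [jE nj _ sz r]]]] := right_mul_run_cons k nl.
exists (j :: l1); split=> //; rewrite right_paddedE /=; exists m => //.
by rewrite /edge /left_value /right_value /= i01 mul1g jE.
Qed.

Lemma biautomatic_normal : biautomatic_structure [set l | normal l].
Proof.
have [i0 i01] := toX simple1.
have word1 l : (size l <= 1)%N -> exists k : X, val k = word_value l.
  case: l => [|i [|//]] _; first by exists i0; rewrite word_value_nil.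
  by exists i; rewrite word_value_cons word_value_nil mulg1.
pose left_rel k l l' := [/\ normal l, normal l' & val k * word_value l = word_value l'].
pose right_rel k l l' := [/\ normal l, normal l' & word_value l * val k = word_value l'].
have reg_left k : regular [set w | exists l l', left_rel k l l' /\ w = right_padded l l'].
  have := regular_setI (regular_right_padded regular_normal regular_normal)
    (regular_run (edge left_value right_value) k i0).
  congr regular; apply/seteqP; split=> w /=.
    move=> [[l [l' [nl nl' ->]]] r]; exists l, l'; split=> //; split=> //.
    by have := run_edge r; have [-> ->] := padded_value l l'; rewrite i01 mulg1.
  move=> [l [l' [[nl nl' e] ->]]]; split; first by exists l, l'.
  by have [] := left_mul_run i01 nl nl' e.
have reg_right k : regular [set w | exists l l', right_rel k l l' /\ w = right_padded l l'].
  have := regular_setI (regular_right_padded regular_normal regular_normal)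
    (regular_run (edge right_value left_value) i0 k).
  congr regular; apply/seteqP; split=> w /=.
    move=> [[l [l' [nl nl' ->]]] r]; exists l, l'; split=> //; split=> //.
    by have := run_edge r; have [-> ->] := padded_value l l'; rewrite i01 mul1g.
  move=> [l [l' [[nl nl' e] ->]]]; split; first by exists l, l'.
  by have [] := right_mul_run i01 nl nl' e.
have unfold_rel (e : seq X -> seq X -> Prop) (P : seq X -> seq X -> seq (pair_letter X)) :
    regular [set w | exists l l', [/\ normal l, normal l' & e l l'] /\ w = P l l'] ->
    regular [set w | exists l l', [/\ normal l, normal l', e l l' & w = P l l']].
  congr regular.
  by apply/seteqP; split=> w /= -[l [l' H]]; exists l, l'; move: H => [] // [].
split=> x /word1[k kE]; rewrite -kE; apply: unfold_rel.
- apply: regular_left_padded (reg_left k) => l l' [nl nl'].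
  by case/(left_mul_run i01 nl nl').
- exact: reg_left.
- apply: regular_left_padded (reg_right k) => l l' [nl nl'].
  by case/(right_mul_run i01 nl nl').
- exact: reg_right.
Qed.

End Words.
End Divisors.

Theorem theorem27 (M : monoidType) :
  left_divisibility_monoid M -> biautomatic M.
Proof.
move=> M_ldm; pose X := fset_set [set w : M | simple w].
have X_simple (a : M) : a \in X <-> simple a.
  by rewrite in_fset_set ?inE //; apply: finite_simple.
exists X, [set l | normal l]; split; last exact: (biautomatic_normal M_ldm X_simple).
  case: (M_ldm) => _ [_ gen] _ _ a; have [s [irr <-]] := gen a.
  exists s; split=> // x /irr xirr; apply/X_simple.
  exact: irreducible_simple xirr.
by move=> a; have [l nl la] := normal_ex M_ldm X_simple a; exists l.
Qed.
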